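(* Let $\underline C=\inf_{\boldsymbol\alpha\ge 0}\{\mathbf b\cdot\boldsymbol\alpha+\Phi^K(\boldsymbol\alpha)\}+\mathbf b\cdot\mathbf E[\bar{\mathbf D}]$, and let $\varphi^K$ be the optimal objective value of the stochastic program without non-negativity constraints defined in the context. Then $$\underline C=\varphi^K+\mathbf b\cdot\mathbf E[\bar{\mathbf D}].$$
   Context: There are $m$ products and $n$ components. $A=(a_{ji})$ is an $n\times m$ non-negative integer matrix with at least one non-zero entry in every row and every column. The components are partitioned into $K$ consecutive groups of sizes $n_1,\dots,n_K$; $\bar n_0=0$, $\bar n_k=\sum_{k'\le k}n_{k'}$, $\bar n_K=n$; $A^k$ is the submatrix of rows $\bar n_{k-1}+1,\dots,\bar n_k$ of $A$. $\mathbf h\in\mathbb R^n$, $\mathbf b\in\mathbb R^m$ have strictly positive entries, $\mathbf h^k=(h_{\bar n_{k-1}+1},\dots,h_{\bar n_k})$, and $\mathbf c=\mathbf b+\sum_{k=1}^K(A^k)'\mathbf h^k$. Demand: lead times $0=L_0<L_1<\dots<L_K$; demand is an $m$-dimensional compound Poisson process $\mathcal D(t)$, $t\ge -L_K$, with i.i.d. non-negative integer-valued order-size vectors $\mathbf S=(S_1,\dots,S_m)$ (coordinates possibly dependent), $\mathbf E[S_i^6]<\infty$. $\mathbf D^1,\dots,\mathbf D^K$ are independent, $\mathbf D^k$ having the distribution of $\mathcal D(t-L_{k-1})-\mathcal D(t-L_k)$, and $\bar{\mathbf D}=\mathbf D^K+\dots+\mathbf D^1$ (which has the distribution of $\mathcal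 D(t)-\mathcal D(t-L_K)$). For $\boldsymbol\alpha\in\mathbb R^m_+$, $\Phi^K(\boldsymbol\alpha)$ is defined by $$\Phi^K(\boldsymbol\alpha)=\inf_{\mathbf y^K\ge0}\{\mathbf h^K\cdot\mathbf y^K+\mathbf E[\Phi^{K-1}(\mathbf y^K,\boldsymbol\alpha+\mathbf D^K)]\},$$ $$\Phi^k(\mathbf y^{k+1},\dots,\mathbf y^K,\mathbf x)=\inf_{\mathbf y^k\ge0}\{\mathbf h^k\cdot\mathbf y^k+\mathbf E[\Phi^{k-1}(\mathbf y^k,\dots,\mathbf y^K,\mathbf x+\mathbf D^k)]\},\quad k=K-1,\dots,1,$$ $$\Phi^0(\mathbf y^1,\dots,\mathbf y^K,\mathbf x)=-\max_{\mathbf z\ge0}\{\mathbf c\cdot\mathbf z\mid\mathbf z\le\mathbf x,\ A^k\mathbf z\le\mathbf y^k,\ 1\le k\le K\}.$$ $\varphi^K$ is defined by $$\varphi^K=\inf_{\mathbf y^K\in\mathbb R^{n_K}}\{\mathbf h^K\cdot\mathbf y^K+\mathbf E[\varphi^{K-1}(\mathbf y^K,\mathbf D^K)]\},$$ $$\varphi^k(\mathbf y^{k+1},\dots,\mathbf y^K,\mathbf x)=\inf_{\mathbf y^k\in\mathbb R^{n_k}}\{\mathbf h^k\cdot\mathbf y^k+\mathbf E[\varphi^{k-1}(\mathbf y^k,\dots,\mathbf y^K,\mathbf x+\mathbf D^k)]\},\quad 1\le k<K,$$ $$\varphi^0(\mathbf y^1,\dots,\mathbf y^K,\mathbf x)=-\max_{\mathbf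 z\in\mathbb R^m}\{\mathbf c\cdot\mathbf z\mid\mathbf z\le\mathbf x,\ A^k\mathbf z\le\mathbf y^k,\ 1\le k\le K\}.$$ *)

(* Defs.v *)
(* MathComp / MathComp-Analysis *)
From HB Require Import structures.
From mathcomp Require Import all_boot all_order all_algebra.
From mathcomp Require Import all_classical all_reals all_analysis.

Set Implicit Arguments.
Unset Strict Implicit.
Unset Printing Implicit Defensive.

Import Order.TTheory GRing.Theory Num.Theory.
Import numFieldNormedType.Exports.

Local Open Scope classical_set_scope.
Local Open Scope ring_scope.

Definition dotv (R : pzSemiRingType) (p : nat) (u v : 'cV[R]_p) : R :=
  \sum_(i < p) u i 0 * v i 0.

Definition lev (R : numDomainType) (p : nat) (u v : 'cV[R]_p) : Prop :=
  forall i, u i 0 <= v i 0.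

Definition natmx (R : pzSemiRingType) (p q : nat) (M : 'M[nat]_(p, q)) :
  'M[R]_(p, q) := map_mx (fun a => a%:R) M.
Arguments natmx R {p q} M.

(* Random elements of a countable set carrying the discrete sigma-algebra,
   so that every set of values is an event. *)

Definition discrete_rv (d : measure_display) (T : measurableType d) (U : Type)
    (X : T -> U) : Prop :=
  forall B : set U, measurable (X @^-1` B).

Definition same_law (d d' : measure_display) (T : measurableType d)
    (T' : measurableType d') (R : realType) (P : probability T R)
    (P' : probability T' R) (U : Type) (X : T -> U) (X' : T' -> U) : Prop :=
  forall B : set U, P (X @^-1` B) = P' (X' @^-1` B).

Definition mutually_independent (d : measure_display) (T : measurableType d)
    (R : realType) (P : probability T R) (I : eqType) (U : Type)
    (X : I -> T -> U) : Prop :=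
  forall (s : seq I) (B : I -> set U), uniq s ->
    P [set w | forall i, i \in s -> B i (X i w)]
    = (\prod_(i <- s) P (X i @^-1` B i))%E.

(* The sigma-algebra generated by the variables X i, i in J. *)
Definition sigma_gen (T I U : Type) (J : set I) (X : I -> T -> U) :
    set (set T) :=
  <<s [set E | exists2 i, J i & exists B : set U, E = X i @^-1` B] >>.

Definition independent_classes (d : measure_display) (T : measurableType d)
    (R : realType) (P : probability T R) (F G : set (set T)) : Prop :=
  forall E E', F E -> G E' -> P (E `&` E') = (P E * P E')%E.

(* N t is the number of arrivals in ]t0, t]. The truncated subtractions are
   genuine increments because paths are nondecreasing. *)
Record poisson_process (d : measure_display) (T : measurableType d)
    (R : realType) (P : probability T R) (lam t0 : R) (N : R -> T -> nat) :
    Prop := PoissonProcess {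
  poisson_process_rv : forall t, t0 <= t -> discrete_rv (N t);
  poisson_process_start : forall w, N t0 w = 0%N;
  poisson_process_mono : forall w s t, t0 <= s -> s <= t ->
    (N s w <= N t w)%N;
  poisson_process_right_cont : forall w t, t0 <= t ->
    \forall s \near t^'+, N s w = N t w;
  poisson_process_incr : forall s t (k : nat), t0 <= s -> s < t ->
    P [set w | (N t w - N s w)%N = k] = (poisson_pmf (lam * (t - s)) k)%:E;
  poisson_process_indep : forall tau : nat -> R, t0 <= tau 0%N ->
    (forall j, tau j <= tau j.+1) ->
    mutually_independent P (fun j w => (N (tau j.+1) w - N (tau j) w)%N)
}.

(* Cumulative demand since time t0: the j-th order to arrive (j = 0, 1, ...)
   has size vector S j. *)
Definition compound_poisson_process (d : measure_display)
    (T : measurableType d) (R : realType) (P : probability T R) (m : nat)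
    (lam t0 : R) (S : nat -> T -> 'cV[nat]_m) (Dem : R -> T -> 'cV[nat]_m) :
    Prop :=
  [/\ forall j, discrete_rv (S j),
      mutually_independent P S,
      forall j, same_law P P (S j) (S 0%N) &
      exists N : R -> T -> nat,
        [/\ poisson_process P lam t0 N,
            independent_classes P (sigma_gen [set t | t0 <= t] N)
              (sigma_gen setT S) &
            forall t w, t0 <= t -> Dem t w = \sum_(j < N t w) S j w]].

(* Throughout, the component groups k = 1, ..., K are indexed by the ordinals
   0, ..., K - 1, and submxcol _ k is the block of consecutive rows of group k.
   A decision (y^1, ..., y^K) is a dependent family of vectors. *)
Definition decisions (R : realType) (K : nat) (nk : 'I_K -> nat) : Type :=
  forall k : 'I_K, 'cV[R]_(nk k).

Definition cost_vector (R : realType) (m K : nat) (nk : 'I_K -> nat)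
    (A : 'M[nat]_(\sum_k nk k, m)) (h : 'cV[R]_(\sum_k nk k))
    (b : 'cV[R]_m) : 'cV[R]_m :=
  b + \sum_(k < K) (submxcol (natmx R A) k)^T *m submxcol h k.

(* C p is the set in which the decision vectors with p entries are constrained
   to lie: the nonnegative orthant for Phi, the whole space for phi. *)

(* The maximum is written as a supremum in the extended reals: it is attained
   whenever the linear program is feasible, and it is -oo otherwise. *)
Definition last_stage (R : realType) (m K : nat) (nk : 'I_K -> nat)
    (A : 'M[nat]_(\sum_k nk k, m)) (h : 'cV[R]_(\sum_k nk k))
    (b : 'cV[R]_m) (C : forall p, set 'cV[R]_p) (y : decisions R nk)
    (x : 'cV[R]_m) : \bar R :=
  (- ereal_sup [set (dotv (cost_vector A h b) z)%:E | z in
      [set z | [/\ C m z, lev z x &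
        forall k, lev (submxcol (natmx R A) k *m z) (y k)]]])%E.

(* stage_value C k y x is the k-th function of the backward recursion. It only
   depends on the blocks of y of the groups k + 1, ..., K, since the recursion
   overwrites (dfwith) the blocks of the groups k, ..., 1 in turn. *)
Fixpoint stage_value (d : measure_display) (T : measurableType d)
    (R : realType) (P : probability T R) (m K : nat) (nk : 'I_K -> nat)
    (A : 'M[nat]_(\sum_k nk k, m)) (h : 'cV[R]_(\sum_k nk k))
    (b : 'cV[R]_m) (D : 'I_K -> T -> 'cV[nat]_m)
    (C : forall p, set 'cV[R]_p) (k : nat) :
    (k <= K)%N -> decisions R nk -> 'cV[R]_m -> \bar R :=
  match k with
  | 0%N => fun _ y x => last_stage A h b C y x
  | k'.+1 => fun (ltk : (k' < K)%N) y x =>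
      let g := Ordinal ltk in
      ereal_inf [set
        ((dotv (submxcol h g) yg)%:E +
         \int[P]_w stage_value P A h b D C (ltnW ltk) (dfwith y g yg)
                     (x + natmx R (D g w)))%E
        | yg in C (nk g)]
  end.

Definition nonneg_orthant (R : realType) (p : nat) : set 'cV[R]_p :=
  [set v | lev 0 v].

Definition whole_space (R : realType) (p : nat) : set 'cV[R]_p := setT.

(* At the top stage no decision has been taken yet, so the family of decisions
   passed to stage_value is irrelevant. *)
Definition PhiK (d : measure_display) (T : measurableType d)
    (R : realType) (P : probability T R) (m K : nat) (nk : 'I_K -> nat)
    (A : 'M[nat]_(\sum_k nk k, m)) (h : 'cV[R]_(\sum_k nk k))
    (b : 'cV[R]_m) (D : 'I_K -> T -> 'cV[nat]_m) (alpha : 'cV[R]_m) :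
    \bar R :=
  stage_value P A h b D (@nonneg_orthant R) (leqnn K) (fun _ => 0) alpha.

Definition phiK (d : measure_display) (T : measurableType d)
    (R : realType) (P : probability T R) (m K : nat) (nk : 'I_K -> nat)
    (A : 'M[nat]_(\sum_k nk k, m)) (h : 'cV[R]_(\sum_k nk k))
    (b : 'cV[R]_m) (D : 'I_K -> T -> 'cV[nat]_m) : \bar R :=
  stage_value P A h b D (@whole_space R) (leqnn K) (fun _ => 0) 0.

(* b . E[Dbar], with Dbar = D^1 + ... + D^K. *)
Definition mean_demand_cost (d : measure_display) (T : measurableType d)
    (R : realType) (P : probability T R) (m K : nat) (b : 'cV[R]_m)
    (D : 'I_K -> T -> 'cV[nat]_m) : \bar R :=
  (\sum_(i < m) (b i 0%R)%:E *
     'E_P[fun w => natmx R (\sum_(k < K) D k w) i 0%R])%E.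

Definition C_lower (d : measure_display) (T : measurableType d)
    (R : realType) (P : probability T R) (m K : nat) (nk : 'I_K -> nat)
    (A : 'M[nat]_(\sum_k nk k, m)) (h : 'cV[R]_(\sum_k nk k))
    (b : 'cV[R]_m) (D : 'I_K -> T -> 'cV[nat]_m) : \bar R :=
  (ereal_inf [set ((dotv b alpha)%:E + PhiK P A h b D alpha)%E
              | alpha in @nonneg_orthant R m]
   + mean_demand_cost P b D)%E.

(* Main.v *)
Require Import Defs.
From HB Require Import structures.
From mathcomp Require Import all_boot all_order all_algebra.
From mathcomp Require Import all_classical all_reals all_analysis.
From mathcomp Require Import measurable_realfun lra ring.

(** Replace the decisions [y^k] by [y^k + A^k a] and the allocation [z] by
    [z + a], starting from inventory position [x + a] instead of [x]. Since
    [c = b + \sum_k (A^k)' h^k], the total cost changes by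
    [\sum_k h^k . A^k a - c . a = - b . a], so [b . a] plus the value of the
    translated program is the value of the program in which the sign
    constraints read [y^k >= - A^k a] and [z >= - a]. Such a program has fewer
    policies than the unconstrained one, whence
    [phi^K <= b . alpha + Phi^K(alpha)] for every [alpha]
    ([whole_le_translate]).

    For the converse take [a = (N, ..., N)]. The constraints become weaker as
    [N] grows, and every single decision [y^k] or [z] satisfies them
    eventually, because each row of [A] has a nonzero entry. Hence the values
    of the constrained programs decrease to the value of the unconstrained one
    ([relaxed_value_cvg]), by induction on the number of remaining stages. The
    limit is taken under the expectations by monotone convergence, which needs
    an integrable upper bound: once the translated decisions and inventory
    position are nonnegative, the policy that decides [0] at every later stage
    bounds the value by a constant which does not depend on the demand
    ([relaxed_value_bounded]).

    Expectations may be infinite; with the convention [+oo - oo = -oo] they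
    are monotone and commute with the addition of constants for arbitrary
    measurable extended-real functions ([integral_mono], [integralD_cst]), and
    these two properties carry the translation through the recursion. *)

Set Implicit Arguments.
Unset Strict Implicit.
Unset Printing Implicit Defensive.

Import Order.TTheory GRing.Theory Num.Theory.
Import numFieldNormedType.Exports.
Local Open Scope classical_set_scope.
Local Open Scope ring_scope.

(** * Expectations of extended-real functions *)

Lemma integral_mono d (T : measurableType d) (R : realType)
    (P : probability T R) (f g : T -> \bar R) :
  measurable_fun setT f -> measurable_fun setT g ->
  (forall w, f w <= g w)%E -> (\int[P]_w f w <= \int[P]_w g w)%E.
Proof.
move=> mf mg fg; rewrite [leLHS]integralE [leRHS]integralE.
apply: leeB; apply: ge0_le_integral => //; try exact: measurable_funepos;
  try exact: measurable_funeneg.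
- by move=> w _; rewrite (@funepos_le _ _ setT) ?inE// => x _.
- by move=> w _; rewrite (@funeneg_le _ _ setT) ?inE// => x _.
Qed.

(** The negative parts of [f] and [f + c] differ by at most [c], so their
    integrals are either both infinite, and then both sides are [-oo], or both
    finite, and then they can be moved across the equation [parts] between
    nonnegative integrals. *)
Lemma integralD_cst_ge0 d (T : measurableType d) (R : realType)
    (P : probability T R) (f : T -> \bar R) (c : R) :
  measurable_fun setT f -> 0 <= c ->
  (\int[P]_w (f w + c%:E) = \int[P]_w f w + c%:E)%E.
Proof.
move=> mf c0; pose g w := (f w + c%:E)%E.
have mg : measurable_fun setT g by apply: emeasurable_funD.
have Pc : (\int[P]_w c%:E = c%:E)%E.
  by rewrite (integral_cst P)// [X in (_ * X)%E](probability_setT P) mule1.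
have mfp := measurable_funepos mf; have mfn := measurable_funeneg mf.
have mgp := measurable_funepos mg; have mgn := measurable_funeneg mg.
have parts : (\int[P]_w g^\+ w + \int[P]_w f^\- w =
              \int[P]_w f^\+ w + (\int[P]_w g^\- w + c%:E))%E.
  rewrite -[in RHS]Pc -!ge0_integralD//; last first.
  - exact: emeasurable_funD.
  - by move=> w _; rewrite adde_ge0.
  apply: eq_integral => w _; rewrite !funeposE !funenegE /g.
  case: (f w) => [r| |] /=; rewrite ?maxye ?maxNye ?add0e ?addye//.
  rewrite -?EFinN -!EFin_max -!EFinD; congr EFin.
  by rewrite /Num.max; do !case: ifPn; rewrite -?leNgt; lra.
have gf : (\int[P]_w g^\- w <= \int[P]_w f^\- w)%E.
  apply: ge0_le_integral => // w _; apply: (@funeneg_le _ _ setT).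
    by move=> x _; rewrite leeDl.
  by rewrite inE.
have fg : (\int[P]_w f^\- w <= \int[P]_w g^\- w + c%:E)%E.
  rewrite -[in leRHS]Pc -ge0_integralD//.
  apply: ge0_le_integral => //; first exact: emeasurable_funD.
  move=> w _; rewrite ![in leRHS]funenegE ![in leLHS]funenegE /g.
  case: (f w) => [r| |] /=; rewrite ?maxye ?maxNye ?add0e ?addye//.
  rewrite -?EFinN -!EFin_max -!EFinD lee_fin.
  by rewrite /Num.max; do !case: ifPn; rewrite -?leNgt; lra.
rewrite [LHS]integralE [in RHS]integralE -/g.
have g0 : (0 <= \int[P]_w g^\- w)%E by exact: integral_ge0.
have f0 : (0 <= \int[P]_w f^\- w)%E by exact: integral_ge0.
move: g0 f0 parts gf fg.
move: (\int[P]_w g^\+ w)%E (\int[P]_w f^\+ w)%E => a b.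
move: (\int[P]_w g^\- w)%E (\int[P]_w f^\- w)%E => [u| |] [v| |]//=; last first.
  by rewrite !addeNy.
move: a b => [a| |] [b| |]//= _ _ [] E _ _; congr EFin; lra.
Qed.

Lemma integralD_cst d (T : measurableType d) (R : realType)
    (P : probability T R) (f : T -> \bar R) (c : R) :
  measurable_fun setT f ->
  (\int[P]_w (f w + c%:E) = \int[P]_w f w + c%:E)%E.
Proof.
move=> mf; have [c0|c0] := leP 0 c; first exact: integralD_cst_ge0.
have mg : measurable_fun setT (fun w => f w + c%:E)%E.
  exact: emeasurable_funD.
have Nc0 : 0 <= - c by rewrite oppr_ge0 ltW.
have -> : (\int[P]_w f w = \int[P]_w (f w + c%:E + (- c)%:E))%E.
  by apply: eq_integral => w _; rewrite EFinN addeK.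
by rewrite (integralD_cst_ge0 P mg Nc0) EFinN subeK.
Qed.

(** Monotone convergence for the increasing nonnegative functions [M - f n];
    the limit [g] may have integral [-oo]. *)
Lemma integral_decreasing_cvg d (T : measurableType d) (R : realType)
    (P : probability T R) (f : (T -> \bar R)^nat) (g : T -> \bar R) (M : R) :
  (forall n, measurable_fun setT (f n)) ->
  (forall n w, f n w <= M%:E)%E ->
  (forall w, {homo f^~ w : n p / (n <= p)%N >-> (p <= n)%E}) ->
  (forall w, f^~ w @ \oo --> g w) ->
  (fun n => \int[P]_w f n w)%E @ \oo --> (\int[P]_w g w)%E.
Proof.
move=> mf fM f_decr f_g.
have mg : measurable_fun setT g.
  exact: (emeasurable_fun_cvg f).
pose f' n w := (M%:E - f n w)%E.
have mf' n : measurable_fun setT (f' n).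
  by apply: emeasurable_funB.
have gM w : (g w <= M%:E)%E.
  by apply: (cvge_le _ (f_g w)); apply: nearW => n; exact: fM.
have reflect u : measurable_fun setT u -> (forall w, u w <= M%:E)%E ->
    (\int[P]_w u w = - (\int[P]_w (M%:E - u w)) + M%:E)%E.
  move=> mu uM; rewrite -integral_ge0N; last by move=> w _; rewrite subre_ge0//.
  rewrite -integralD_cst; last first.
    by apply: measurableT_comp => //; exact: emeasurable_funB.
  by apply: eq_integral => w _; case: (u w) => // r; congr EFin; ring.
have cvg_reflect : (fun n => \int[P]_w (M%:E - f n w))%E @ \oo -->
    (\int[P]_w (M%:E - g w))%E.
  have -> : (\int[P]_w (M%:E - g w) = \int[P]_w limn (f'^~ w))%E.
    apply: eq_integral => w _; apply/esym/cvg_lim => //.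
    by apply: cvgeB => //; exact: cvg_cst.
  apply: cvg_monotone_convergence => //.
  - by move=> n w _; rewrite /f' subre_ge0.
  - by move=> w _ n p np; rewrite leeB// f_decr.
rewrite (reflect g)//; under eq_fun do rewrite (reflect (f _))//.
apply: cvgeD => //; first by rewrite fin_num_adde_defl.
  exact/cvgeNP.
exact: cvg_cst.
Qed.

(** All value functions are measurable for this reason: they are evaluated at
    random demands that carry the discrete sigma-algebra. *)
Lemma measurable_discrete_rv d (T : measurableType d) (R : realType)
    (U : Type) (X : T -> U) (F : U -> \bar R) :
  discrete_rv X -> measurable_fun setT (fun w => F (X w)).
Proof. by move=> dX _ B mB; rewrite setTI; exact: (dX (F @^-1` B)). Qed.

(** * Vectors *)

Lemma dotvDr (R : realType) p (u v w : 'cV[R]_p) :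
  dotv u (v + w) = dotv u v + dotv u w.
Proof.
by rewrite /dotv -big_split; apply: eq_bigr => i _; rewrite mxE mulrDr.
Qed.

Lemma dotvDl (R : realType) p (u v w : 'cV[R]_p) :
  dotv (u + v) w = dotv u w + dotv v w.
Proof.
by rewrite /dotv -big_split; apply: eq_bigr => i _; rewrite mxE mulrDl.
Qed.

Lemma dotv0r (R : realType) p (u : 'cV[R]_p) : dotv u 0 = 0.
Proof. by rewrite /dotv big1// => i _; rewrite mxE mulr0. Qed.

Lemma dotvNr (R : realType) p (u v : 'cV[R]_p) : dotv u (- v) = - dotv u v.
Proof. by rewrite /dotv -sumrN; apply: eq_bigr => i _; rewrite mxE mulrN. Qed.

Lemma dotvE (R : realType) p (u v : 'cV[R]_p) : dotv u v = (u^T *m v) 0 0.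
Proof. by rewrite !mxE; apply: eq_bigr => i _; rewrite mxE. Qed.

Lemma dotv_trmul (R : realType) p q (M : 'M[R]_(p, q))
    (u : 'cV[R]_p) (v : 'cV[R]_q) :
  dotv (M^T *m u) v = dotv u (M *m v).
Proof. by rewrite !dotvE trmx_mul trmxK mulmxA. Qed.

Lemma dotv_suml (R : realType) p (I : Type) (r : seq I) (Q : pred I)
    (F : I -> 'cV[R]_p) v :
  dotv (\sum_(i <- r | Q i) F i) v = \sum_(i <- r | Q i) dotv (F i) v.
Proof.
elim/big_rec2: _ => [|i u w _ <-]; last by rewrite dotvDl.
by rewrite /dotv big1// => i _; rewrite mxE mul0r.
Qed.

Lemma lev0D (R : realType) p (u v : 'cV[R]_p) :
  lev 0 u -> lev 0 v -> lev 0 (u + v).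
Proof.
move=> u0 v0 i; have := u0 i; have := v0 i; rewrite !mxE => v0i u0i.
exact: addr_ge0.
Qed.

Lemma near_lev0_ray (R : realType) p (u v : 'cV[R]_p) :
  (forall i, 1 <= v i 0) -> \forall N \near \oo, lev 0 (u + N%:R *: v).
Proof.
move=> v1.
exists (\sum_(i < p) Num.bound `|u i 0%R|%R)%N => // N /= uN i.
rewrite !mxE -lerBlDl sub0r.
have : (Num.bound `|u i 0%R|%R <= N)%N.
  by apply: leq_trans uN; rewrite (bigD1 i)//= leq_addr.
rewrite -(ler_nat R) => bN.
apply: (@le_trans _ _ N%:R); last by rewrite ler_peMr.
apply: le_trans bN; apply: le_trans (ltW (archi_boundP (normr_ge0 _))).
by rewrite -normrN ler_norm.
Qed.

(** * The backward recursion *)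

Section StageValue.
Context (R : realType) (m K : nat) (nk : 'I_K -> nat).
Context (A : 'M[nat]_(\sum_k nk k, m)) (h : 'cV[R]_(\sum_k nk k)).
Context (b : 'cV[R]_m).
Context (d : measure_display) (T : measurableType d) (P : probability T R).
Context (D : 'I_K -> T -> 'cV[nat]_m) (D_rv : forall k, discrete_rv (D k)).

Local Notation Ak g := (submxcol (natmx R A) g).
Local Notation hk g := (submxcol h g).
Local Notation c := (cost_vector A h b).
Local Notation V := (stage_value P A h b D).

Lemma last_stage_ge (C : forall p, set 'cV[R]_p) (y : decisions R nk) x v :
  (forall z, C m z -> lev z x -> (forall k, lev (Ak k *m z) (y k)) ->
    v <= (- dotv c z)%:E)%E ->
  (v <= last_stage A h b C y x)%E.
Proof.
move=> vz; rewrite /last_stage leeNr.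
apply: ge_ereal_sup => _ [z [Cz zx zy] <-].
by rewrite leeNr; exact: vz.
Qed.

Lemma last_stage_le (C : forall p, set 'cV[R]_p) (y : decisions R nk) x z :
  C m z -> lev z x -> (forall k, lev (Ak k *m z) (y k)) ->
  (last_stage A h b C y x <= (- dotv c z)%:E)%E.
Proof.
move=> Cz zx zy; rewrite /last_stage EFinN leeN2.
by apply: ereal_sup_ubound; exists z.
Qed.

Lemma stage_value_le (C : forall p, set 'cV[R]_p) k (kK : (k < K)%N) y x yg :
  C (nk (Ordinal kK)) yg ->
  (V C kK y x <= (dotv (hk (Ordinal kK)) yg)%:E +
     \int[P]_w V C (ltnW kK) (dfwith y (Ordinal kK) yg)
                    (x + natmx R (D (Ordinal kK) w)))%E.
Proof. by move=> Cy; apply: ereal_inf_lbound; exists yg. Qed.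

Lemma measurable_stage (C : forall p, set 'cV[R]_p) k (kK : (k <= K)%N) g y x :
  measurable_fun setT (fun w => V C kK y (x + natmx R (D g w))).
Proof. exact: (measurable_discrete_rv (fun u => V C kK y (x + natmx R u))). Qed.

Lemma stage_value_antitone (C C' : forall p, set 'cV[R]_p) :
  (forall p, C p `<=` C' p) ->
  forall k (kK : (k <= K)%N) y x, (V C' kK y x <= V C kK y x)%E.
Proof.
move=> CC'; elim=> [|k IH] kK y x.
  by apply: last_stage_ge => z Cz zx zy; apply: last_stage_le => //; exact: CC'.
apply: le_ereal_inf_tmp => _ [yg Cyg <-].
apply: (le_trans (stage_value_le _ _ (CC' _ _ Cyg))).
apply: leeD => //; apply: integral_mono => //; exact: measurable_stage.
Qed.

Lemma stage_value_eq (C : forall p, set 'cV[R]_p) k (kK : (k <= K)%N) y y' x :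
  (forall g : 'I_K, (k <= g)%N -> y g = y' g) -> V C kK y x = V C kK y' x.
Proof.
elim: k kK y y' x => [|k IH] kK y y' x yy' /=.
  by have -> : y = y' by apply: functional_extensionality_dep => g; exact: yy'.
congr ereal_inf; apply: eq_imagel => yg _; congr (_ + _)%E.
apply: eq_integral => w _; apply: IH => g.
case: dfwithP => [|j gj] kj; rewrite ?dfwithin// dfwithout//; apply: yy'.
by rewrite ltn_neqAle kj andbT; apply: contraNneq gj => jk; apply/eqP/val_inj.
Qed.

Definition translate (a : 'cV[R]_m) (y : decisions R nk) : decisions R nk :=
  fun g => y g + Ak g *m a.

(** What must be added to the value with [k] stages to go after a translation by
    [a]: the allocation gains [c . a], and the [k] decisions still to be taken
    cost [h^g . A^g a] more. *)
Definition translate_cost (k : nat) (a : 'cV[R]_m) : R :=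
  dotv c a - \sum_(g < K | (g < k)%N) dotv (hk g) (Ak g *m a).

(** This is where the definition of the cost vector [c] enters: over all stages
    the holding costs cancel and [b . a] remains. *)
Lemma translate_costK a : translate_cost K a = dotv b a.
Proof.
rewrite /translate_cost /cost_vector dotvDl dotv_suml.
rewrite [X in _ - X](eq_bigl xpredT); last by move=> g; rewrite ltn_ord.
by rewrite -addrA -sumrB big1 ?addr0// => g _; rewrite dotv_trmul subrr.
Qed.

Lemma translate_cost0 a : translate_cost 0 a = dotv c a.
Proof. by rewrite /translate_cost [X in _ - X]big_pred0 ?subr0. Qed.

Lemma translate_costS k (kK : (k < K)%N) a :
  dotv (hk (Ordinal kK)) (Ak (Ordinal kK) *m a) + translate_cost k.+1 a =
  translate_cost k a.
Proof.
rewrite /translate_cost [X in _ + (_ - X)](bigD1 (Ordinal kK))//=.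
rewrite [X in _ - (_ + X)](eq_bigl (fun g : 'I_K => (g < k)%N)); first ring.
by move=> g; rewrite ltnS -val_eqE /= [RHS]ltn_neqAle andbC.
Qed.

Lemma translate_costD k a a' :
  translate_cost k (a + a') = translate_cost k a + translate_cost k a'.
Proof.
rewrite /translate_cost dotvDr addrACA -opprD; congr (_ - _).
rewrite -big_split /=; apply: eq_bigr => g _.
by rewrite mulmxDr dotvDr.
Qed.

Lemma translate_costN k a : translate_cost k (- a) = - translate_cost k a.
Proof.
rewrite /translate_cost dotvNr opprD; congr (_ - _); rewrite -sumrN.
by apply: eq_bigr => g _; rewrite mulmxN dotvNr.
Qed.

Lemma translate_dfwith a y (g : 'I_K) yg :
  dfwith (translate a y) g (yg + Ak g *m a) = translate a (dfwith y g yg).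
Proof.
apply: functional_extensionality_dep => j; rewrite /translate.
by case: dfwithP => [|j' gj']; rewrite ?dfwithin ?dfwithout.
Qed.

Lemma last_stage_translate (C : forall p, set 'cV[R]_p) (kK : (0 <= K)%N)
    a y x z :
  C m (z + a) -> lev z x -> (forall g, lev (Ak g *m z) (y g)) ->
  (V C kK (translate a y) (x + a) + (translate_cost 0 a)%:E <=
   (- dotv c z)%:E)%E.
Proof.
move=> Cz zx zy; rewrite -leeBrDr// translate_cost0 -EFinB -opprD -dotvDr.
apply: last_stage_le => // [i|g i].
  by rewrite [leLHS]mxE [leRHS]mxE lerD2r.
by rewrite mulmxDr [leLHS]mxE [leRHS]mxE lerD2r; exact: zy.
Qed.

(** Choosing [yg + Ak g *m a] in the translated problem costs the extra amount
    which separates [translate_cost k.+1] from [translate_cost k]. *)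
Lemma stage_value_translate_le (C : forall p, set 'cV[R]_p) k (kK : (k < K)%N)
    a y x yg (g := Ordinal kK) :
  C (nk g) (yg + Ak g *m a) ->
  (V C kK (translate a y) (x + a) + (translate_cost k.+1 a)%:E <=
   (dotv (hk g) yg)%:E +
   \int[P]_w (V C (ltnW kK) (translate a (dfwith y g yg))
                (x + natmx R (D g w) + a) + (translate_cost k a)%:E))%E.
Proof.
move=> Cyg; apply: (le_trans (leeD (stage_value_le _ _ Cyg) (lexx _))).
rewrite -addeA dotvDr EFinD -addeA; apply: leeD => //.
rewrite addeCA -EFinD (translate_costS kK) -integralD_cst; last first.
  exact: measurable_stage.
under eq_integral do rewrite translate_dfwith addrAC.
exact: lexx.
Qed.

(** A policy for [(y, x)] gives one for the translated problem: add [a] to [z]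
    and [A^k a] to each [y^k]. Its cost differs by [translate_cost] exactly. *)
Lemma stage_value_translate (C : forall p, set 'cV[R]_p) a :
  (forall g v, C (nk g) v -> C (nk g) (v + Ak g *m a)) ->
  (forall z, C m z -> C m (z + a)) ->
  forall k (kK : (k <= K)%N) y x,
  (V C kK (translate a y) (x + a) + (translate_cost k a)%:E <= V C kK y x)%E.
Proof.
move=> Cy Cz; elim=> [|k IH] kK y x.
  apply: last_stage_ge => z zC zx zy.
  by apply: last_stage_translate => //; exact: Cz.
apply: le_ereal_inf_tmp => _ [yg Cyg <-].
apply: (le_trans (stage_value_translate_le _ _ (Cy _ _ Cyg))).
apply: leeD => //.
apply: integral_mono => [||w]; last exact: IH.
- exact: (measurable_discrete_rv (fun u =>
    V C _ _ (x + natmx R u + a) + (translate_cost k a)%:E)%E).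
- exact: measurable_stage.
Qed.

Lemma translateD a a' y : translate a (translate a' y) = translate (a + a') y.
Proof.
apply: functional_extensionality_dep => g.
by rewrite /translate mulmxDr addrAC addrA.
Qed.

Lemma translate0 y : translate 0 y = y.
Proof.
by apply: functional_extensionality_dep => g; rewrite /translate mulmx0 addr0.
Qed.

(** * Relaxing the sign constraints *)

Local Notation nn := (@nonneg_orthant R).
Local Notation whole := (@whole_space R).

Lemma Ak_mul_ge0 g (a : 'cV[R]_m) : lev 0 a -> lev 0 (Ak g *m a).
Proof.
move=> a0 i; rewrite !mxE sumr_ge0// => j _.
by rewrite mulr_ge0//; [rewrite !mxE ler0n|have := a0 j; rewrite mxE].
Qed.

(** The policy [0] stays feasible because demands are nonnegative. *)
Lemma stage_value_nonneg_le0 k (kK : (k <= K)%N) y x :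
  (forall g, lev 0 (y g)) -> lev 0 x -> (V nn kK y x <= 0)%E.
Proof.
elim: k kK y x => [|k IH] kK y x y0 x0.
  have -> : 0%E = (- dotv c 0)%:E by rewrite dotv0r oppr0.
  by apply: last_stage_le => // g; rewrite mulmx0.
have nn0 : @nonneg_orthant R (nk (Ordinal kK)) 0 by [].
apply: (le_trans (stage_value_le _ _ nn0)).
rewrite dotv0r add0e -(@integral0 _ _ _ P setT).
apply: integral_mono => // [|w]; first exact: measurable_stage.
apply: IH => [g|]; first by case: dfwithP.
by apply: lev0D => // i; rewrite !mxE ler0n.
Qed.

Local Notation ones := (const_mx 1 : 'cV[R]_m).

(** The value of the program with the constraints [y^g >= - A^g (N, ..., N)]
    and [z >= - (N, ..., N)]: writing it as a translate of the program with
    constraints [>= 0] avoids a second recursion with other constraint sets. *)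
Definition relaxed_value k (kK : (k <= K)%N) (y : decisions R nk) x (N : nat) :=
  (V nn kK (translate (N%:R *: ones) y) (x + N%:R *: ones) +
   (translate_cost k (N%:R *: ones))%:E)%E.

Lemma relaxed_value_decreasing k (kK : (k <= K)%N) y x :
  {homo relaxed_value kK y x : N N' / (N <= N')%N >-> (N' <= N)%E}.
Proof.
move=> N N' NN'; rewrite /relaxed_value.
have -> : N'%:R *: ones = (N' - N)%:R *: ones + N%:R *: ones.
  by rewrite -scalerDl -natrD subnK.
have step0 : lev 0 ((N' - N)%:R *: ones).
  by move=> i; rewrite !mxE mulr1 ler0n.
rewrite translate_costD EFinD -translateD.
rewrite [_ *: _ + _ in leLHS]addrC (addrA x) addeA leeD//.
apply: stage_value_translate => [g v v0|z z0]; apply: lev0D => //.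
exact: Ak_mul_ge0.
Qed.

(** The unconstrained program is invariant under translation, up to
    [translate_cost]: translate back by [- a]. *)
Lemma whole_le_translate k (kK : (k <= K)%N) y x a :
  (V whole kK y x <=
   V nn kK (translate a y) (x + a) + (translate_cost k a)%:E)%E.
Proof.
apply: (@le_trans _ _
  (V whole kK (translate a y) (x + a) + (translate_cost k a)%:E)%E).
  have := @stage_value_translate whole (- a) (fun _ _ _ => I) (fun _ _ => I)
    k kK (translate a y) (x + a).
  by rewrite translateD addNr translate0 addrK translate_costN EFinN leeBlDr.
by apply: leeD => //; apply: stage_value_antitone.
Qed.

Lemma Ak_ones_ge1 : (forall j, exists i, A j i != 0%N) ->
  forall g i, 1 <= (Ak g *m ones) i 0.
Proof.
move=> A_row g i; rewrite submxcol_mul mxE mxE.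
set r := (X in natmx R A X); have [j Aj] := A_row r.
rewrite (bigD1 j)//= !mxE mulr1 -[leLHS]addr0 lerD//.
  by rewrite ler1n lt0n.
by apply: sumr_ge0 => l _; rewrite !mxE mulr1 ler0n.
Qed.

Context (A_row : forall j, exists i, A j i != 0%N).

Lemma near_decision_nonneg g v :
  \forall N \near \oo, lev 0 (v + Ak g *m (N%:R *: ones)).
Proof.
near=> N; rewrite -scalemxAr; near: N; apply: near_lev0_ray => i.
exact: Ak_ones_ge1.
Unshelve. all: by end_near. Qed.

Lemma near_position_nonneg x : \forall N \near \oo, lev 0 (x + N%:R *: ones).
Proof. by apply: near_lev0_ray => i; rewrite mxE. Qed.

Lemma near_decisions_nonneg y :
  \forall N \near \oo, forall g, lev 0 (translate (N%:R *: ones) y g).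
Proof. by apply: filter_forall => g; exact: near_decision_nonneg. Qed.

(** The threshold and the bound are uniform in the demand [u], which only
    increases [x]; this is what monotone convergence requires. *)
Lemma relaxed_value_bounded y x :
  exists N0, forall k (kK : (k <= K)%N) u N, (N0 <= N)%N ->
  (relaxed_value kK y (x + natmx R u) N <=
   (translate_cost k (N0%:R *: ones))%:E)%E.
Proof.
have [N0 _ yx0] :=
  filterI (near_decisions_nonneg y) (near_position_nonneg x).
exists N0 => k kK u N N0N.
apply: (le_trans (relaxed_value_decreasing kK y _ N0N)).
have [y0 x0] := yx0 N0 (leqnn _).
rewrite /relaxed_value -[leRHS]add0e; apply: leeD => //.
apply: stage_value_nonneg_le0 => //.
rewrite addrAC; apply: lev0D => // i.
by rewrite !mxE ler0n.
Qed.

(** The values decrease to their infimum, which is at least the unconstrained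
    value. Conversely, fix one unconstrained decision [yg]: it is feasible for
    all large [N], and the induction hypothesis passes to the limit in the
    expectation of what follows it. *)
Lemma relaxed_value_cvg k (kK : (k <= K)%N) y x :
  relaxed_value kK y x @ \oo --> V whole kK y x.
Proof.
have infE : forall k (kK : (k <= K)%N) y x,
    (ereal_inf (range (relaxed_value kK y x)) <= V whole kK y x)%E ->
    relaxed_value kK y x @ \oo --> V whole kK y x.
  move=> {}k {}kK {}y {}x le_inf.
  have -> : V whole kK y x = ereal_inf (range (relaxed_value kK y x)).
    apply/le_anti/andP; split => //.
    by apply: le_ereal_inf_tmp => _ [N _ <-]; exact: whole_le_translate.
  exact/ereal_nonincreasing_cvgn/relaxed_value_decreasing.
elim: k kK y x => [|k IH] kK y x; apply: infE.
  apply: last_stage_ge => z _ zx zy.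
  have [N _ zN] := near_position_nonneg z.
  apply: ge_ereal_inf; exists (relaxed_value kK y x N); first by exists N.
  by apply: last_stage_translate => //; exact: zN (leqnn N).
apply: le_ereal_inf_tmp => _ [yg _ <-].
set g := Ordinal kK; set y' := dfwith y g yg.
(* Monotone convergence applies to the tail of the sequence from [N0] on. *)
have [N0 bounded] := relaxed_value_bounded y' x.
have [N1 _ yg0] := near_decision_nonneg yg.
have relaxed_step N : (N1 <= N)%N -> (relaxed_value kK y x N <=
    (dotv (hk g) yg)%:E +
    \int[P]_w relaxed_value (ltnW kK) y' (x + natmx R (D g w)) N)%E.
  by move=> N1N; apply: stage_value_translate_le; exact: yg0.
have int_cvg : (fun n => \int[P]_w
      relaxed_value (ltnW kK) y' (x + natmx R (D g w)) (n + N0)%N)%E @ \oo -->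
    (\int[P]_w V whole (ltnW kK) y' (x + natmx R (D g w)))%E.
  apply: (integral_decreasing_cvg (M := translate_cost k (N0%:R *: ones))).
  - move=> n; exact: (measurable_discrete_rv
      (fun u => relaxed_value (ltnW kK) y' (x + natmx R u) (n + N0)%N)).
  - by move=> n w; apply: bounded; rewrite leq_addl.
  - by move=> w n p np; apply: relaxed_value_decreasing; rewrite leq_add2r.
  - by move=> w; rewrite (cvg_shiftn N0); exact: IH.
rewrite -leeBlDl//; apply: cvge_ge int_cvg.
exists N1 => // N N1N; rewrite leeBlDl//.
apply: le_trans (relaxed_step (N + N0)%N (leq_trans N1N (leq_addr _ _))).
by apply: ereal_inf_lbound; exists (N + N0)%N.
Qed.

Lemma inf_PhiK :
  ereal_inf [set ((dotv b alpha)%:E + PhiK P A h b D alpha)%E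
            | alpha in @nonneg_orthant R m] = phiK P A h b D.
Proof.
(* The initial decisions are irrelevant, so the translated and the original
   ones give the same value. *)
have translateE a : (V nn (leqnn K) (translate a (fun=> 0%R)) (0%R + a)%R +
    (translate_cost K a)%:E = (dotv b a)%:E + PhiK P A h b D a)%E.
  rewrite translate_costK addeC add0r; congr (_ + _)%E.
  by apply: stage_value_eq => g; rewrite leqNgt ltn_ord.
apply/le_anti/andP; split.
  have cv := @relaxed_value_cvg K (leqnn K) (fun=> 0) 0.
  rewrite /phiK; apply: cvge_ge cv; apply: nearW => N.
  rewrite /relaxed_value translateE; apply: ereal_inf_lbound.
  exists (N%:R *: ones) => //.
  by move=> i; rewrite !mxE mulr1 ler0n.
apply: le_ereal_inf_tmp => _ [a _ <-]; rewrite -translateE.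
exact: whole_le_translate.
Qed.
End StageValue.

Theorem theorem2 (R : realType)
  (* m products, K component groups of sizes nk, n = \sum_k nk k components *)
  (m K : nat) (K_gt0 : (0 < K)%N) (nk : 'I_K -> nat)
  (A : 'M[nat]_(\sum_k nk k, m))
  (A_row : forall j, exists i, A j i != 0%N)
  (A_col : forall i, exists j, A j i != 0%N)
  (h : 'cV[R]_(\sum_k nk k)) (h_gt0 : forall j, 0 < h j 0)
  (b : 'cV[R]_m) (b_gt0 : forall i, 0 < b i 0)
  (* lead times *)
  (L : nat -> R) (L_0 : L 0%N = 0)
  (L_incr : forall k, (k < K)%N -> L k < L k.+1)
  (* the demand process on [- L_K, +oo[ *)
  (d0 : measure_display) (T0 : measurableType d0) (P0 : probability T0 R)
  (lam : R) (lam_gt0 : 0 < lam)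
  (S : nat -> T0 -> 'cV[nat]_m) (Dem : R -> T0 -> 'cV[nat]_m)
  (Dem_compound_poisson : compound_poisson_process P0 lam (- L K) S Dem)
  (S_moment6 : forall i,
     ('E_P0[fun w => ((S 0%N w i 0)%:R ^+ 6)%R] < +oo)%E)
  (* the lead time demands D^1, ..., D^K *)
  (d : measure_display) (T : measurableType d) (P : probability T R)
  (D : 'I_K -> T -> 'cV[nat]_m)
  (D_rv : forall k, discrete_rv (D k))
  (D_indep : mutually_independent P D)
  (t : R) (t_ge0 : 0 <= t)
  (D_law : forall k : 'I_K,
     same_law P P0 (fun w => natmx R (D k w))
       (fun w => natmx R (Dem (t - L k) w) - natmx R (Dem (t - L k.+1) w))) :
  C_lower P A h b D = (phiK P A h b D + mean_demand_cost P b D)%E.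
Proof. by rewrite /C_lower inf_PhiK. Qed.
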